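(* Let $(s^{-1}B,\{b_{m,n}\},\{d_m\})$ be a $\mathcal B_\infty$-algebra, let $(A,\cdot,d_A)$ be a dg associative algebra and $\{\beta_m\}_{m>1}$ an action of $s^{-1}B$ on $A$. Define $\mathbf{k}$-linear maps $$\{b'_{m,n}:(A\oplus B)^{\otimes(m+n)}\to A\oplus B\}_{m,n>0},\qquad \{d'_m:(A\oplus B)^{\otimes m}\to A\oplus B\}_{m>0}$$ as follows: for all $b_i\in B$, $a,a_i\in A$, $$b'_{m,n}(b_1,\dots,b_{m+n}):=b_{m,n}(b_1,\dots,b_{m+n}),\quad b'_{1,1}(a_1,a_2):=a_1\cdot a_2,\quad d'_1(a):=d_A(a),$$ $$d'_m(b_1,\dots,b_m):=d_m(b_1,\dots,b_m),\quad b'_{m,1}(b_1,\dots,b_m,a):=\beta_{m+1}(b_1,\dots,b_m,a),$$ $$b'_{m,1}(a_1,b_1,\dots,b_{m-1},a_2):=a_1\cdot\beta_m(b_1,\dots,b_{m-1},a_2),$$ and for the rest of the possibilities the values are $0$. Set $b'_{0,1}=b'_{1,0}=\mathrm{Id}$ and $b'_{0,m}=b'_{m,0}=0$ for $m\neq1$. Then $(s^{-1}(A\oplus B),\{b'_{m,n}\}_{m,n\ge0},\{d'_m\}_{m>0})$ is a $\mathcal B_\infty$-algebra.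
   Context: $\mathbf{k}$ is a field of characteristic $0$; spaces are $\mathbb{Z}$-graded, differentials raise degree by $1$, $s^{-1}$ is desuspension. In an exponent of $-1$ a homogeneous element stands for its degree. **$\mathcal B_\infty$-algebra.** A $\mathcal B_\infty$-structure on $s^{-1}B$ is a set of linear maps $b_{m,n}:B^{\otimes(m+n)}\to B$ of degree $0$ ($m,n\ge0$) and $d_m:B^{\otimes m}\to B$ of degree $1$ ($m>0$), with $b_{0,1}=b_{1,0}=\mathrm{Id}_B$, $b_{0,m}=b_{m,0}=0$ for $m\ne1$, such that $\{d_m\}$ is an $\mathcal A_\infty$-structure on $s^{-1}B$ (i.e. $\sum_{l+m=n+1}d_l\circ\widehat d_m=0$ on $B^{\otimes n}$, where $\widehat d_p(v_1,\dots,v_n)=\sum_{0\le i\le n-p}(-1)^{v_1+\dots+v_i}v_1\otimes\dots\otimes d_p(v_{i+1},\dots,v_{i+p})\otimes\dots\otimes v_n$), and, with $$b_p(u_1,\dots,u_m;v_1,\dots,v_n):=\sum\pm\bigotimes_{1\le q\le p}b_{i_q,j_q}(u_{\bar i_{q-1}+1},\dots,u_{\bar i_q},v_{\bar j_{q-1}+1},\dots,v_{\bar j_q})$$ (sum over $i_q,j_q\ge0$ with $\sum i_q=m$, $\sum j_q=n$; $\bar i_q=\sum_{r\le q}i_r$, $\bar j_q=\sum_{r\le q}j_r$; Koszul sign of the permutation of the arguments), for all $l,m,n\in\mathbb N$: $$\sum_{p>0}b_{p,n}(b_p(u_1,\dots,u_l;v_1,\dots,v_m),w_1,\dots,w_n)=\sum_{p>0}b_{l,p}(u_1,\dots,u_l,b_p(v_1,\dots,v_m;w_1,\dots,w_n)),$$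 $$\sum_{p>0}d_p(b_p(u_1,\dots,u_m;v_1,\dots,v_n))=\sum_{p>0}\big(b_{m-p+1,n}(\widehat d_p(u_1,\dots,u_m),v_1,\dots,v_n)+(-1)^{u_1+\dots+u_m}b_{m,n-p+1}(u_1,\dots,u_m,\widehat d_p(v_1,\dots,v_n))\big).$$ **Module over $s^{-1}B$.** A module structure on a dg space $(W,d_W)$ is a set of degree $0$ linear maps $\beta_m:B^{\otimes(m-1)}\otimes W\to W$, $m>1$, with $$\sum_{p>1}\beta_p(b_{p-1}(u_1,\dots,u_m;v_1,\dots,v_n),w)=\beta_{m+1}(u_1,\dots,u_m,\beta_{n+1}(v_1,\dots,v_n,w)),$$ $$d_W(\beta_m(v_1,\dots,v_{m-1},w))=\sum_{p=1}^{m-1}\beta_{m-p+1}(\widehat d_p(v_1,\dots,v_{m-1}),w)+(-1)^{v_1+\dots+v_{m-1}}\beta_m(v_1,\dots,v_{m-1},d_W(w)).$$ **Action on a dg associative algebra $(A,\cdot,d_A)$.** A module structure $\{\beta_m\}_{m>1}$ on $A$ such that, with $\beta_1:=\mathrm{Id}_A$, $$\beta_m(v_1,\dots,v_{m-1},a_1\cdot a_2)=\sum_{i=0}^{m-1}(-1)^{a_1(v_{i+1}+\dots+v_{m-1})}\beta_{i+1}(v_1,\dots,v_i,a_1)\cdot\beta_{m-i}(v_{i+1},\dots,v_{m-1},a_2).$$ *)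

(* Defs.v *)
(* Mathematical Components. *)
From mathcomp Require Import all_boot all_order all_algebra.

Set Implicit Arguments.
Unset Strict Implicit.
Unset Printing Implicit Defensive.

Import GRing.Theory.
Local Open Scope ring_scope.

(* A Z-graded space is a vector space that is the internal direct sum of the
   subspaces [hom i], i in Z. *)
Record grading (k : fieldType) (V : lmodType k) := Grading {
  hom :> int -> V -> Prop;
  hom0 : forall i, hom i 0;
  homZD : forall i (c : k) x y, hom i x -> hom i y -> hom i (c *: x + y);
  hom_span : forall v, exists (s : seq int) (f : int -> V),
    [/\ uniq s, forall i, hom i (f i) & v = \sum_(i <- s) f i];
  hom_direct : forall (s : seq int) (f : int -> V),
    uniq s -> (forall i, hom i (f i)) -> \sum_(i <- s) f i = 0 ->
    forall i, i \in s -> f i = 0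
}.

(* A homogeneous element, together with its degree. *)
Record homog (k : fieldType) (V : lmodType k) (G : grading V) := Homog {
  hdeg : int;
  hval : V;
  hvalP : hom G hdeg hval
}.

Definition vals (k : fieldType) (V : lmodType k) (G : grading V)
  (us : seq (homog G)) : seq V := [seq hval u | u <- us].

Definition tdeg (k : fieldType) (V : lmodType k) (G : grading V)
  (us : seq (homog G)) : int := \sum_(u <- us) hdeg u.

(* A function [f : seq V -> W] stands for the family of its restrictions
   f_n : V^n -> W to sequences of size n.  It is [multilinear] when every f_n
   is, that is, when every f_n is a linear map from the n-th tensor power of V
   to W. *)
Definition multilinear (k : fieldType) (V W : lmodType k) (f : seq V -> W) :=
  forall (s t : seq V) (c : k) (x y : V),
    f (s ++ (c *: x + y) :: t) = c *: f (s ++ x :: t) + f (s ++ y :: t).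

(* All the sequences of p natural numbers with sum n. *)
Fixpoint compositions (p n : nat) : seq (seq nat) :=
  if p is p'.+1 then
    flatten [seq [seq i :: c | c <- compositions p' (n - i)] | i <- iota 0 n.+1]
  else if n == 0%N then [:: [::]] else [::].

Lemma compositionsS p n : compositions p.+1 n =
  flatten [seq [seq i :: c | c <- compositions p (n - i)] | i <- iota 0 n.+1].
Proof. by []. Qed.

Lemma mem_compositions p n c :
  (c \in compositions p n) = (size c == p) && (sumn c == n).
Proof.
elim: p n c => [|p IH] n c.
  by case: c => [|x c] /=; case: n => [|n].
rewrite compositionsS; apply/idP/idP => [/flatten_mapP [i] |].
  rewrite mem_iota add0n ltnS => /= le_in /mapP[c' + ->] /=.
  by rewrite IH eqSS => /andP[-> /eqP ->]; rewrite subnKC ?eqxx.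
case: c => [|i c] //; rewrite [size _]/= [sumn _]/= eqSS => /andP[sz /eqP <-].
apply/flatten_mapP; exists i; first by rewrite mem_iota add0n ltnS leq_addr.
by apply/mapP; exists c; rewrite // IH sz addKn eqxx.
Qed.

Lemma compositions_uniq p n : uniq (compositions p n).
Proof.
elim: p n => [|p IH] n; first by case: n.
rewrite compositionsS; apply: allpairs_uniq_dep; first exact: (iota_uniq 0 n.+1).
  by move=> i _; apply: IH.
by move=> [i c] [j c'] _ _ /= [-> ->].
Qed.

(* The exponent of the Koszul sign of the permutation taking
     (us_0, ..., us_(p-1), vs_0, ..., vs_(p-1))  to  (us_0, vs_0, us_1, vs_1, ...),
   where the us_q and the vs_q are blocks of homogeneous elements: its inversions
   are the pairs of an element of us_r and an element of vs_q with q < r. *)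
Definition koszul (k : fieldType) (V : lmodType k) (G : grading V)
  (us vs : seq (seq (homog G))) : int :=
  \sum_(r < size us) \sum_(q < r) tdeg (nth [::] us r) * tdeg (nth [::] vs q).

(* For [f : seq V -> W] multilinear, [after_b b p f us vs] is
   f (b_p (us; vs)), where b_p (us; vs) is in the p-th tensor power of V. *)
Definition after_b (k : fieldType) (V W : lmodType k) (G : grading V)
  (b : seq V -> seq V -> V) (p : nat) (f : seq V -> W)
  (us vs : seq (homog G)) : W :=
  \sum_(i <- compositions p (size us)) \sum_(j <- compositions p (size vs))
    (-1 : k) ^ koszul (reshape i us) (reshape j vs) *:
      f [seq b (vals x.1) (vals x.2) | x <- zip (reshape i us) (reshape j vs)].

(* For [f : seq V -> W] multilinear, [after_dhat d p f vs] is
   f (\hat d_p (vs)); it is 0 if p exceeds the size of vs. *)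
Definition after_dhat (k : fieldType) (V W : lmodType k) (G : grading V)
  (d : seq V -> V) (p : nat) (f : seq V -> W) (vs : seq (homog G)) : W :=
  \sum_(0 <= i < (size vs).+1 - p)
    (-1 : k) ^ tdeg (take i vs) *:
      f (vals (take i vs) ++ d (vals (take p (drop i vs))) ::
         vals (drop (i + p) vs)).

(* [d vs] is d_m (vs) for m the size of vs; the field [Ainf_d0] expresses that
   there is no d_0. *)
Record Ainfty (k : fieldType) (B : lmodType k) (G : grading B)
  (d : seq B -> B) : Prop := {
  Ainf_multilinear : multilinear d;
  Ainf_d0 : d [::] = 0;
  Ainf_deg : forall vs : seq (homog G), hom G (tdeg vs + 1) (d (vals vs));
  Ainf_rel : forall vs : seq (homog G),
    \sum_(1 <= m < (size vs).+1) after_dhat d m d vs = 0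
}.

(* A B_infty-structure on s^-1 B, given by maps on the tensor powers of B:
   [b us vs] is b_(m,n) (us; vs) for m, n the sizes of us, vs.
   As b_(0,0) = 0, the tensor b_p (us; vs) vanishes for p > m + n, so the sums
   over p are finite.  In [Binf_assoc], the term p = 0 is nonzero only when both
   arguments of b_p are empty, in which case b_0 is the empty tensor 1 and b_p
   vanishes for p > 0; without this term the relation would contradict
   b_(0,1) = b_(1,0) = Id at (l, m, n) = (0, 0, 1) and (1, 0, 0). *)
Record Binfty (k : fieldType) (B : lmodType k) (G : grading B)
  (b : seq B -> seq B -> B) (d : seq B -> B) : Prop := {
  Binf_multilinearl : forall vs, multilinear (fun us => b us vs);
  Binf_multilinearr : forall us, multilinear (b us);
  Binf_deg : forall us vs : seq (homog G),
    hom G (tdeg us + tdeg vs) (b (vals us) (vals vs));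
  Binf_b01 : forall v, b [::] [:: v] = v;
  Binf_b10 : forall v, b [:: v] [::] = v;
  Binf_b0m : forall vs, size vs != 1%N -> b [::] vs = 0;
  Binf_bm0 : forall us, size us != 1%N -> b us [::] = 0;
  Binf_Ainfty : Ainfty G d;
  Binf_assoc : forall us vs ws : seq (homog G),
    \sum_(0 <= p < (size us + size vs).+1)
      after_b b p (fun ts => b ts (vals ws)) us vs =
    \sum_(0 <= p < (size vs + size ws).+1)
      after_b b p (fun ts => b (vals us) ts) vs ws;
  Binf_diff : forall us vs : seq (homog G),
    \sum_(1 <= p < (size us + size vs).+1) after_b b p d us vs =
    \sum_(1 <= p < (size us).+1)
      after_dhat d p (fun ts => b ts (vals vs)) us +
    (-1 : k) ^ tdeg us *:
      \sum_(1 <= p < (size vs).+1)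
        after_dhat d p (fun ts => b (vals us) ts) vs
}.

Record dg_space (k : fieldType) (W : lmodType k) (G : grading W)
  (dW : W -> W) : Prop := {
  dg_linear : linear dW;
  dg_deg : forall i w, hom G i w -> hom G (i + 1) (dW w);
  dg_sq : forall w, dW (dW w) = 0
}.

(* Associative, not necessarily unital. *)
Record dg_algebra (k : fieldType) (A : lmodType k) (G : grading A)
  (mul : A -> A -> A) (dA : A -> A) : Prop := {
  dga_space : dg_space G dA;
  dga_linearl : forall y, linear (fun x => mul x y);
  dga_linearr : forall x, linear (mul x);
  dga_deg : forall i j x y, hom G i x -> hom G j y -> hom G (i + j) (mul x y);
  dga_assoc : forall x y z, mul (mul x y) z = mul x (mul y z);
  dga_leibniz : forall i x y, hom G i x ->
    dA (mul x y) = mul (dA x) y + (-1 : k) ^ i *: mul x (dA y)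
}.

(* [beta vs w] is beta_m (vs, w) for m - 1 the size of vs; the convention
   beta_1 = Id is part of the definition.  The sum over p > 1 of the terms
   beta_p (b_(p-1) (us; vs), w) is indexed here by p - 1; its term 0 vanishes
   unless us and vs are both empty. *)
Record Bmodule (k : fieldType) (B : lmodType k) (GB : grading B)
  (b : seq B -> seq B -> B) (d : seq B -> B)
  (W : lmodType k) (GW : grading W) (dW : W -> W)
  (beta : seq B -> W -> W) : Prop := {
  Bmod_multilinearl : forall w, multilinear (fun vs => beta vs w);
  Bmod_linearr : forall vs, linear (beta vs);
  Bmod_deg : forall (vs : seq (homog GB)) i w,
    hom GW i w -> hom GW (tdeg vs + i) (beta (vals vs) w);
  Bmod_beta1 : forall w, beta [::] w = w;
  Bmod_assoc : forall (us vs : seq (homog GB)) w,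
    \sum_(0 <= q < (size us + size vs).+1)
      after_b b q (fun ts => beta ts w) us vs =
    beta (vals us) (beta (vals vs) w);
  Bmod_diff : forall (vs : seq (homog GB)) w,
    dW (beta (vals vs) w) =
    \sum_(1 <= p < (size vs).+1) after_dhat d p (fun ts => beta ts w) vs +
    (-1 : k) ^ tdeg vs *: beta (vals vs) (dW w)
}.

Record Baction (k : fieldType) (B : lmodType k) (GB : grading B)
  (b : seq B -> seq B -> B) (d : seq B -> B)
  (A : lmodType k) (GA : grading A) (mul : A -> A -> A) (dA : A -> A)
  (beta : seq B -> A -> A) : Prop := {
  Bact_module : Bmodule GB b d GA dA beta;
  Bact_mul : forall (vs : seq (homog GB)) (a1 : homog GA) a2,
    beta (vals vs) (mul (hval a1) a2) =
    \sum_(0 <= i < (size vs).+1)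
      (-1 : k) ^ (hdeg a1 * tdeg (drop i vs)) *:
        mul (beta (vals (take i vs)) (hval a1)) (beta (vals (drop i vs)) a2)
}.

Section Sum.

Variables (k : fieldType) (A B : lmodType k).

Section Grading.

Variables (GA : grading A) (GB : grading B).

Definition sum_hom (i : int) (x : A * B) : Prop := hom GA i x.1 /\ hom GB i x.2.

Lemma sum_hom0 i : sum_hom i 0.
Proof. by split; apply: hom0. Qed.

Lemma sum_homZD i (c : k) x y :
  sum_hom i x -> sum_hom i y -> sum_hom i (c *: x + y).
Proof. by move=> [? ?] [? ?]; split; apply: homZD. Qed.

Lemma big_pairE (s : seq int) (f : int -> A * B) :
  \sum_(i <- s) f i = (\sum_(i <- s) (f i).1, \sum_(i <- s) (f i).2).
Proof.
elim: s => [|i s IH]; first by rewrite !big_nil.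
by rewrite !big_cons IH; case: (f i).
Qed.

Lemma big_extend (V : lmodType k) (s t : seq int) (f : int -> V) :
  uniq s -> uniq t -> {subset s <= t} ->
  \sum_(i <- t) (if i \in s then f i else 0) = \sum_(i <- s) f i.
Proof.
move=> us ut st; rewrite -big_mkcond -big_filter; apply: perm_big.
apply: uniq_perm; rewrite ?filter_uniq // => i.
by rewrite mem_filter; case: (boolP (i \in s)) => //= /st ->.
Qed.

Lemma sum_hom_span v : exists (s : seq int) (f : int -> A * B),
  [/\ uniq s, forall i, sum_hom i (f i) & v = \sum_(i <- s) f i].
Proof.
case: v => a b.
have [s [f [us hf ->]]] := hom_span GA a.
have [t [g [ut hg ->]]] := hom_span GB b.
exists (undup (s ++ t)).
exists (fun i => (if i \in s then f i else 0, if i \in t then g i else 0)).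
split; first exact: undup_uniq.
  by move=> i; split=> /=; case: ifP => _ //; apply: hom0.
rewrite big_pairE /= !big_extend ?undup_uniq // => i it;
  by rewrite mem_undup mem_cat it ?orbT.
Qed.

Lemma sum_hom_direct (s : seq int) (f : int -> A * B) :
  uniq s -> (forall i, sum_hom i (f i)) -> \sum_(i <- s) f i = 0 ->
  forall i, i \in s -> f i = 0.
Proof.
move=> us hf; rewrite big_pairE => -[fA fB] i si.
rewrite [f i]surjective_pairing.
rewrite (hom_direct us (fun j => proj1 (hf j)) fA si).
by rewrite (hom_direct us (fun j => proj2 (hf j)) fB si).
Qed.

Definition sum_grading : grading (A * B)%type :=
  Grading sum_hom0 sum_homZD sum_hom_span sum_hom_direct.

End Grading.

Variables (mul : A -> A -> A) (dA : A -> A).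
Variables (b : seq B -> seq B -> B) (d : seq B -> B) (beta : seq B -> A -> A).

(* The maps b' and d' on A (+) B, extended multilinearly from arguments in A or
   in B; the lemmas below give their values on such arguments.  The two summands
   in the third case are beta_(m+1) (b_1, ..., b_m, a) and
   a_1 . beta_m (b_1, ..., b_(m-1), a_2); for m = 1 the latter is a_1 . a_2. *)
Definition bsum (us vs : seq (A * B)) : A * B :=
  (match us, vs with
   | [::], [:: y] => y.1
   | [:: x], [::] => x.1
   | x :: us', [:: y] =>
       beta (map snd us) y.1 + mul x.1 (beta (map snd us') y.1)
   | _, _ => 0
   end,
   b (map snd us) (map snd vs)).

Definition dsum (us : seq (A * B)) : A * B :=
  (if us is [:: x] then dA x.1 else 0, d (map snd us)).

Definition inA (a : A) : A * B := (a, 0).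
Definition inB (x : B) : A * B := (0, x).

Definition pure (t : A + B) : A * B :=
  match t with inl a => inA a | inr x => inB x end.
Definition isB (t : A + B) : bool := if t is inr _ then true else false.

Section Values.

Variables (GA : grading A) (GB : grading B).
Hypotheses (Hb : Binfty GB b d) (HA : dg_algebra GA mul dA).
Hypothesis (Hbeta : Baction GB b d GA mul dA beta).

Lemma multilinear0 (V W : lmodType k) (f : seq V -> W) s :
  multilinear f -> 0 \in s -> f s = 0.
Proof.
move=> mf /path.splitPr [s1 s2].
by have := mf s1 s2 (-1) 0 0; rewrite scaler0 addr0 scaleN1r addNr.
Qed.

Lemma linear0_of (V W : lmodType k) (f : V -> W) : linear f -> f 0 = 0.
Proof.
by move=> lf; have := lf (-1) 0 0; rewrite scaler0 addr0 scaleN1r addNr.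
Qed.

Lemma beta0 vs : beta vs 0 = 0.
Proof. exact: linear0_of (Bmod_linearr (Bact_module Hbeta) vs). Qed.

Lemma mul0l a : mul 0 a = 0.
Proof. exact: linear0_of (dga_linearl HA a). Qed.

Lemma mul0r a : mul a 0 = 0.
Proof. exact: linear0_of (dga_linearr HA a). Qed.

Lemma map_snd_inB xs : map snd (map inB xs) = xs.
Proof. by rewrite -map_comp map_id_in. Qed.

Lemma bsum_unit1 x : bsum [::] [:: x] = x.
Proof. by rewrite /bsum /= (Binf_b01 Hb); case: x. Qed.

Lemma bsum_unit2 x : bsum [:: x] [::] = x.
Proof. by rewrite /bsum /= (Binf_b10 Hb); case: x. Qed.

Lemma bsum_unit3 vs : size vs != 1%N -> bsum [::] vs = 0.
Proof.
move=> sz; rewrite /bsum /= (Binf_b0m Hb) ?size_map //.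
by case: vs sz => [|? []].
Qed.

Lemma bsum_unit4 us : size us != 1%N -> bsum us [::] = 0.
Proof.
move=> sz; rewrite /bsum /= (Binf_bm0 Hb) ?size_map //.
by case: us sz => [|? []].
Qed.

Lemma bsumB us vs : bsum (map inB us) (map inB vs) = inB (b us vs).
Proof.
rewrite /bsum !map_snd_inB /inB; congr pair.
by case: us vs => [|x [|x' us]] [|y [|y' vs]] //=; rewrite !beta0 mul0r addr0.
Qed.

Lemma bsumAA a1 a2 : bsum [:: inA a1] [:: inA a2] = inA (mul a1 a2).
Proof.
have Hm := Bact_module Hbeta.
rewrite /bsum /inA /= (Bmod_beta1 Hm).
rewrite (multilinear0 (Bmod_multilinearl Hm a2)) ?inE ?eqxx // add0r.
by rewrite (multilinear0 (Binf_multilinearr Hb _)) ?inE ?eqxx.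
Qed.

Lemma bsumBA us a :
  (0 < size us)%N -> bsum (map inB us) [:: inA a] = inA (beta us a).
Proof.
rewrite /bsum !map_snd_inB /inA /= => sz.
rewrite (multilinear0 (Binf_multilinearr Hb _)) ?inE ?eqxx //; congr pair.
by case: us sz => [|x us] //= _; rewrite map_snd_inB mul0l addr0; case: us.
Qed.

Lemma bsumABA a1 us a2 :
  bsum (inA a1 :: map inB us) [:: inA a2] = inA (mul a1 (beta us a2)).
Proof.
have Hm := Bact_module Hbeta.
rewrite /bsum /= map_snd_inB /inA /=.
rewrite (multilinear0 (Binf_multilinearr Hb _)) ?inE ?eqxx //; congr pair.
by case: us => [|x us] /=;
   rewrite (multilinear0 (Bmod_multilinearl Hm a2)) ?inE ?eqxx ?add0r.
Qed.

Lemma zero_snd (us : seq (A + B)) :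
  ~~ all isB us -> 0 \in map snd (map pure us).
Proof.
by elim: us => [|[a|x] us IH] //=; rewrite inE ?eqxx // => /IH ->; rewrite orbT.
Qed.

(* The remaining cases. *)
Lemma bsum_rest (us vs : seq (A + B)) :
  (0 < size us)%N -> (0 < size vs)%N ->
  ~~ (all isB us && all isB vs) ->
  ~~ [&& all isB (behead us), size vs == 1%N & ~~ all isB vs] ->
  bsum (map pure us) (map pure vs) = 0.
Proof.
have Hm := Bact_module Hbeta.
move=> su sv nB nA; rewrite /bsum.
have -> : b (map snd (map pure us)) (map snd (map pure vs)) = 0.
  move: nB; rewrite negb_and => /orP[] /zero_snd z.
    exact: (multilinear0 (Binf_multilinearl Hb _)).
  exact: (multilinear0 (Binf_multilinearr Hb _)).
congr pair; case: us vs su sv nB nA => [|x us] [|y [|y' vs]] //= _ _; last first.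
  by case: us.
case: y => [a|y] /= _; last first.
  by move=> _; rewrite !beta0 mul0r addr0; case: us.
rewrite andbT => /zero_snd z.
have -> : beta (map snd (map pure us)) a = 0.
  exact: (multilinear0 (Bmod_multilinearl Hm a)).
have -> : beta ((pure x).2 :: map snd (map pure us)) a = 0.
  by apply: (multilinear0 (Bmod_multilinearl Hm a)); rewrite inE z orbT.
by rewrite mul0r addr0; case: us {z}.
Qed.

Lemma dsumA a : dsum [:: inA a] = inA (dA a).
Proof.
rewrite /dsum /= (multilinear0 (Ainf_multilinear (Binf_Ainfty Hb))) //.
by rewrite inE.
Qed.

Lemma dsumB us : dsum (map inB us) = inB (d us).
Proof.
rewrite /dsum map_snd_inB; congr pair.
by case: us => [|x []] //=; exact: linear0_of (dg_linear (dga_space HA)).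
Qed.

Lemma dsum_rest (us : seq (A + B)) :
  size us != 1%N -> ~~ all isB us -> dsum (map pure us) = 0.
Proof.
move=> sz /zero_snd z; rewrite /dsum.
rewrite (multilinear0 (Ainf_multilinear (Binf_Ainfty Hb))) //.
by case: us sz {z} => [|? []].
Qed.

End Values.

End Sum.

(* Main.v *)
Require Import Defs.
From mathcomp Require Import all_boot all_order all_algebra zify.

(* The projection of A (+) B onto B is a strict morphism, so the B-components of
   the relations are those of the given structure.  For the A-components, let
   x_1, ..., x_m in A (+) B act on a in A by
     Phi (x_1, ..., x_m; a) = beta (x_1, ..., x_m; a) + x_1 . beta (x_2, ..., x_m; a),
   where beta only sees the B-components of its arguments.  The relations reduce
   to Phi (us; Phi (vs; a)) = Phi (us * vs; a) and to the Leibniz rule for d_A and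
   Phi.  Both follow by splitting off the first tensor factor from the relations
   for beta, together with the compatibility of beta with the product. *)

Set Implicit Arguments.
Unset Strict Implicit.
Unset Printing Implicit Defensive.

Import GRing.Theory.
Local Open Scope ring_scope.

(** * Maps satisfying [linear]: sums, scalars, finite sums *)

Section Linear.

Variables (k : fieldType) (V W : lmodType k) (f : V -> W).
Hypothesis lf : linear f.

Lemma linear_propD x y : f (x + y) = f x + f y.
Proof. by have := lf 1 x y; rewrite !scale1r. Qed.

Lemma linear_propZ c x : f (c *: x) = c *: f x.
Proof. by have := lf c x 0; rewrite (linear0_of lf) !addr0. Qed.

Lemma linear_prop_sum I (r : seq I) (P : pred I) (F : I -> V) :
  f (\sum_(i <- r | P i) F i) = \sum_(i <- r | P i) f (F i).
Proof. exact: (big_morph f linear_propD (linear0_of lf)). Qed.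

End Linear.

Lemma homD (k : fieldType) (V : lmodType k) (G : grading V) i x y :
  G i x -> G i y -> G i (x + y).
Proof. by move=> hx hy; have := homZD 1 hx hy; rewrite scale1r. Qed.

Lemma multilinear_cons (k : fieldType) (V W : lmodType k) (f : seq V -> W) x :
  multilinear f -> multilinear (fun ts => f (x :: ts)).
Proof. by move=> mf s t c y z; exact: (mf (x :: s)). Qed.

(** * Koszul signs, and functionals applied to b_p and to \hat d_p *)

Section Tensor.

Variables (k : fieldType) (V : lmodType k) (G : grading V).
Implicit Types us vs : seq (homog G).

Lemma signrD (m n : int) : (-1 : k) ^ (m + n) = (-1) ^ m * (-1) ^ n.
Proof. by rewrite expfzDr // oppr_eq0 oner_eq0. Qed.

Lemma tdeg_nil : tdeg ([::] : seq (homog G)) = 0.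
Proof. exact: big_nil. Qed.

Lemma tdeg_cons u us : tdeg (u :: us) = hdeg u + tdeg us.
Proof. exact: big_cons. Qed.

Lemma tdeg_cat us vs : tdeg (us ++ vs) = tdeg us + tdeg vs.
Proof. exact: big_cat. Qed.

Lemma tdeg_flatten (uss : seq (seq (homog G))) :
  tdeg (flatten uss) = \sum_(us <- uss) tdeg us.
Proof.
elim: uss => [|us uss IH] /=; first by rewrite tdeg_nil big_nil.
by rewrite tdeg_cat big_cons IH.
Qed.

(** The block [vs] has to pass every block of [uss], while [us] already stands first and passes
    nothing. *)
Lemma koszul_cons us vs (uss vss : seq (seq (homog G))) :
  koszul (us :: uss) (vs :: vss) =
  koszul uss vss + tdeg (flatten uss) * tdeg vs.
Proof.
rewrite /koszul /= big_ord_recl big_ord0 add0r tdeg_flatten.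
rewrite (big_nth [::]) big_mkord mulr_suml -big_split /=.
by apply: eq_bigr => r _; rewrite big_ord_recl addrC.
Qed.

Variables (W : lmodType k) (b : seq V -> seq V -> V) (d : seq V -> V).
Implicit Types f g : seq V -> W.

Lemma eq_after_b p f g us vs :
  f =1 g -> after_b b p f us vs = after_b b p g us vs.
Proof.
by move=> fg; apply: eq_bigr => i _; apply: eq_bigr => j _; rewrite fg.
Qed.

Lemma after_bD p f g us vs :
  after_b b p (fun ts => f ts + g ts) us vs =
  after_b b p f us vs + after_b b p g us vs.
Proof.
rewrite /after_b -big_split; apply: eq_bigr => i _.
by rewrite -big_split; apply: eq_bigr => j _; rewrite scalerDr.
Qed.

Lemma after_b_linear (U : lmodType k) (h : W -> U) p f us vs :
  linear h -> h (after_b b p f us vs) = after_b b p (fun ts => h (f ts)) us vs.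
Proof.
move=> lh; rewrite /after_b (linear_prop_sum lh); apply: eq_bigr => i _.
by rewrite (linear_prop_sum lh); apply: eq_bigr => j _; rewrite linear_propZ.
Qed.

Lemma after_b0 f us vs :
  after_b b 0 f us vs =
  if (size us == 0%N) && (size vs == 0%N) then f [::] else 0.
Proof.
case: us => [|u us]; last by rewrite /after_b big_nil.
case: vs => [|v vs]; rewrite /after_b /= big_seq1 ?big_nil // big_seq1.
by rewrite /koszul big_ord0 scale1r.
Qed.

(** Recursion on the number of tensor factors: the first factor consumes i entries of [us] and j of
    [vs]. The sign comes from moving these j entries past the entries of [us] that remain. *)
Lemma after_bS p f us vs :
  after_b b p.+1 f us vs =
  \sum_(0 <= i < (size us).+1) \sum_(0 <= j < (size vs).+1)
    (-1 : k) ^ (tdeg (drop i us) * tdeg (take j vs)) *: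
      after_b b p
        (fun ts => f (b (vals (take i us)) (vals (take j vs)) :: ts))
        (drop i us) (drop j vs).
Proof.
rewrite /after_b !compositionsS big_allpairs_dep.
apply: eq_bigr => i _; under eq_bigr do rewrite big_allpairs_dep.
rewrite exchange_big; apply: eq_bigr => j _.
rewrite scaler_sumr !size_drop big_seq [RHS]big_seq.
apply: eq_bigr => c; rewrite mem_compositions => /andP[_ /eqP sc].
rewrite scaler_sumr; apply: eq_bigr => c' _.
rewrite /= koszul_cons reshapeKr ?size_drop ?sc //.
by rewrite addrC signrD scalerA.
Qed.

(** With more factors than arguments, some factor is b_(0,0) = 0. Inductively, either the first
    factor is that one, or it consumes an argument and the other factors still outnumber the
    rest. *)
Lemma after_b_large p f us vs :
  multilinear f -> b [::] [::] = 0 -> (size us + size vs < p)%N ->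
  after_b b p f us vs = 0.
Proof.
move=> mf b00; elim: p f us vs mf => // p IH f us vs mf lt_p.
rewrite after_bS big_nat big1 // => i /andP[_ le_i].
rewrite big_nat big1 // => j /andP[_ le_j].
case: (posnP (i + j)) => [/eqP|ij_gt0]; last first.
  rewrite IH ?scaler0 //; first exact: multilinear_cons.
  by rewrite !size_drop; lia.
rewrite addn_eq0 => /andP[/eqP-> /eqP->]; rewrite !take0 b00.
rewrite /after_b big1 ?scaler0 // => c _; rewrite big1 // => c' _.
by rewrite (multilinear0 mf) ?scaler0 // inE eqxx.
Qed.

Lemma sum_after_b_widen n f us vs :
  multilinear f -> b [::] [::] = 0 -> (size us + size vs < n)%N ->
  \sum_(0 <= p < n) after_b b p f us vs =
  \sum_(0 <= p < (size us + size vs).+1) after_b b p f us vs.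
Proof.
move=> mf b00 lt_n; rewrite (big_cat_nat _ lt_n) //= [X in _ + X]big_nat.
by rewrite [X in _ + X]big1 ?addr0 // => p /andP[lt_p _]; exact: after_b_large.
Qed.

Lemma after_b1 f us vs :
  after_b b 1 f us vs = f [:: b (vals us) (vals vs)].
Proof.
have compositions1 n : compositions 1 n = [:: [:: n]].
  apply: perm_small_eq => //; apply: uniq_perm => //.
    exact: compositions_uniq.
  move=> c; rewrite mem_compositions inE.
  by case: c => [|m [|? ?]] //=; rewrite !eqseq_cons ?addn0 ?andbT ?andbF.
rewrite /after_b !compositions1 !big_seq1 /= !take_size.
by rewrite /koszul /= big_ord_recl !big_ord0 addr0 scale1r.
Qed.

(** Such an [f] sees only p = 1. The condition on b_(0,0) covers empty [us] and [vs], where the sum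
    has no term at all. The A-components of [d'] and of [b'] in its right argument are functionals
    of this kind. *)
Lemma sum_after_b_short f us vs :
  (forall x y ts, f (x :: y :: ts) = 0) -> f [:: b [::] [::]] = 0 ->
  \sum_(1 <= p < (size us + size vs).+1) after_b b p f us vs =
  f [:: b (vals us) (vals vs)].
Proof.
move=> f2 f00; case: (posnP (size us + size vs)) => [|n_gt0].
  by case: us => //; case: vs => // _; rewrite big_geq.
rewrite big_ltn // after_b1 big_nat big1 ?addr0 // => -[|[|p]] // _.
rewrite after_bS big1 // => i _; rewrite big1 // => j _.
rewrite after_bS big1 ?scaler0 // => i' _; rewrite big1 // => j' _.
rewrite /after_b big1 ?scaler0 // => c _; rewrite big1 // => c' _.
by rewrite f2 scaler0.
Qed.

Lemma eq_after_dhat p f g vs :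
  f =1 g -> after_dhat d p f vs = after_dhat d p g vs.
Proof. by move=> fg; apply: eq_bigr => i _; rewrite fg. Qed.

Lemma after_dhatD p f g vs :
  after_dhat d p (fun ts => f ts + g ts) vs =
  after_dhat d p f vs + after_dhat d p g vs.
Proof. by rewrite -big_split; apply: eq_bigr => i _; rewrite scalerDr. Qed.

Lemma after_dhat_linear (U : lmodType k) (h : W -> U) p f vs :
  linear h -> h (after_dhat d p f vs) = after_dhat d p (fun ts => h (f ts)) vs.
Proof.
move=> lh; rewrite /after_dhat (linear_prop_sum lh); apply: eq_bigr => i _.
by rewrite linear_propZ.
Qed.

Lemma after_dhat_cons p f v vs :
  (p <= (size vs).+1)%N ->
  after_dhat d p f (v :: vs) =
  f (d (vals (take p (v :: vs))) :: vals (drop p (v :: vs))) +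
  (-1) ^ hdeg v *: after_dhat d p (fun ts => f (hval v :: ts)) vs.
Proof.
move=> le_p; rewrite /after_dhat subSn // big_nat_recl // take0 drop0 add0n.
rewrite tdeg_nil scale1r scaler_sumr; congr (_ + _); apply: eq_bigr => i _.
by rewrite /= tdeg_cons signrD scalerA.
Qed.

Lemma after_dhat_large p f vs : (size vs < p)%N -> after_dhat d p f vs = 0.
Proof. by move=> lt_p; rewrite /after_dhat big_geq // leqn0 subn_eq0. Qed.

Lemma sum_after_dhat_short f vs :
  (forall x y ts, f (x :: y :: ts) = 0) -> f [:: d [::]] = 0 ->
  \sum_(1 <= p < (size vs).+1) after_dhat d p f vs = f [:: d (vals vs)].
Proof.
move=> f2 f0; case: vs => [|v vs]; first by rewrite big_geq.
(* Behind [hval v] there is always the entry produced by [d], so [f] gets at least two factors. *)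
have dhat0 p : after_dhat d p (fun ts => f (hval v :: ts)) vs = 0.
  by rewrite /after_dhat big1 // => -[|i] _; case: (take _ _) => [|? ?];
    rewrite /= f2 scaler0.
(* The last p is the full length, where [d] absorbs everything; a smaller p leaves a second
   factor. *)
rewrite big_nat_recr //= after_dhat_cons // dhat0 scaler0 addr0 drop_oversize //.
rewrite take_oversize // big_nat big1 ?add0r // => p /andP[_ lt_p].
rewrite after_dhat_cons ?(ltnW lt_p) // dhat0 scaler0 addr0.
by case: p lt_p => [|p] lt_p /=; rewrite ?(drop_nth v lt_p) /= f2.
Qed.

End Tensor.

(** * Components of the maps on A (+) B, and the map Phi *)

Section SumAction.

Variables (k : fieldType) (B : lmodType k) (GB : grading B).
Variables (b : seq B -> seq B -> B) (d : seq B -> B).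
Hypothesis HB : Binfty GB b d.
Variables (A : lmodType k) (GA : grading A) (mul : A -> A -> A) (dA : A -> A).
Hypothesis HA : dg_algebra GA mul dA.
Variable beta : seq B -> A -> A.
Hypothesis Hbeta : Baction GB b d GA mul dA beta.

Notation GS := (sum_grading GA GB).
Notation b' := (bsum mul b beta).
Notation d' := (dsum dA d).
Implicit Types us vs ws : seq (homog GS).

Let Hmod := Bact_module Hbeta.
Let betaZD := Bmod_linearr Hmod.
Let b00 : b [::] [::] = 0 := Binf_b0m HB (isT : size [::] != 1%N).

Definition homog_fst (u : homog GS) : homog GA := Homog (proj1 (hvalP u)).
Definition homog_snd (u : homog GS) : homog GB := Homog (proj2 (hvalP u)).

Lemma linear_fst : linear (fst : A * B -> A). Proof. by []. Qed.
Lemma linear_snd : linear (snd : A * B -> B). Proof. by []. Qed.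

Lemma vals_snd us : map snd (vals us) = vals (map homog_snd us).
Proof. by rewrite /vals -!map_comp. Qed.

Lemma tdeg_snd us : tdeg (map homog_snd us) = tdeg us.
Proof. by rewrite /tdeg big_map. Qed.

Lemma multilinear_map_snd (W : lmodType k) (f : seq B -> W) :
  multilinear f -> multilinear (fun us : seq (A * B) => f (map snd us)).
Proof. by move=> mf s t c x y; rewrite !map_cat; exact: mf. Qed.

(** The projection commutes with the brackets and preserves the recorded degrees, so the same blocks
    occur with the same Koszul signs. *)
Lemma after_b_snd (W : lmodType k) (f : seq B -> W) p us vs :
  after_b b' p (fun ts => f (map snd ts)) us vs =
  after_b b p f (map homog_snd us) (map homog_snd vs).
Proof.
rewrite /after_b !size_map; apply: eq_bigr => i _; apply: eq_bigr => j _.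
rewrite -!map_reshape; congr (_ ^ _ *: f _).
  rewrite /koszul size_map; apply: eq_bigr => r _; apply: eq_bigr => q _.
  have nth_snd n (s : seq (seq (homog GS))) :
      nth [::] (map (map homog_snd) s) n = map homog_snd (nth [::] s n).
    by elim: s n => [|x s IH] [|n] /=.
  by rewrite !nth_snd !tdeg_snd.
elim: (reshape i us) (reshape j vs) => [|x xs IH] [|y ys] //=.
by rewrite !vals_snd IH.
Qed.

Lemma after_dhat_snd (W : lmodType k) (f : seq B -> W) p us :
  after_dhat d' p (fun ts => f (map snd ts)) us =
  after_dhat d p f (map homog_snd us).
Proof.
rewrite /after_dhat size_map; apply: eq_bigr => i _.
by rewrite -map_drop -!map_take -map_drop tdeg_snd map_cat /= !vals_snd.
Qed.

(** The second summand of Phi; the value 0 on the empty list makes Phi of no arguments the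
    identity. *)
Definition head_mul (ts : seq (A * B)) (a : A) : A :=
  if ts is x :: ts' then mul x.1 (beta (map snd ts') a) else 0.

(* Phi, with values the first components of [b' ts [:: y]], for [y.1 = a]. *)
Definition sum_act (ts : seq (A * B)) (a : A) : A :=
  beta (map snd ts) a + head_mul ts a.

Lemma sum_act_nil a : sum_act [::] a = a.
Proof. by rewrite /sum_act (Bmod_beta1 Hmod) addr0. Qed.

(** The unit b_(0,1) = Id needs no separate case, being Phi of the empty list. *)
Lemma fst_bsum (us vs : seq (A * B)) :
  (b' us vs).1 =
  match vs with
  | [::] => if us is [:: x] then x.1 else 0
  | [:: y] => sum_act us y.1
  | _ => 0
  end.
Proof.
case: us vs => [|x [|x' us]] [|y [|z vs]] //=.
by rewrite sum_act_nil.
Qed.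

Lemma fst_bsum1 (us : seq (A * B)) y : (b' us [:: y]).1 = sum_act us y.1.
Proof. exact: fst_bsum. Qed.

Lemma fst_dsum (us : seq (A * B)) :
  (d' us).1 = if us is [:: x] then dA x.1 else 0.
Proof. by []. Qed.

Lemma multilinear_head_mul a : multilinear (fun ts => head_mul ts a).
Proof.
move=> [|z s] t c x y /=; first exact: (dga_linearl HA).
rewrite (multilinear_map_snd (Bmod_multilinearl Hmod a)).
exact: (dga_linearr HA).
Qed.

Lemma multilinear_sum_act a : multilinear (fun ts => sum_act ts a).
Proof.
move=> s t c x y; rewrite /sum_act.
rewrite (multilinear_map_snd (Bmod_multilinearl Hmod a)) multilinear_head_mul.
by rewrite scalerDr addrACA.
Qed.

Lemma linear_sum_act ts : linear (sum_act ts).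
Proof.
move=> c x y; rewrite /sum_act betaZD.
have -> : head_mul ts (c *: x + y) = c *: head_mul ts x + head_mul ts y.
  case: ts => [|t ts] /=; first by rewrite scaler0 addr0.
  by rewrite betaZD; exact: (dga_linearr HA).
by rewrite scalerDr addrACA.
Qed.

(** * Multilinearity and degrees *)

Lemma bsum_multilinearl (vs : seq (A * B)) : multilinear (fun ts => b' ts vs).
Proof.
move=> s t c x y; apply: injective_projections; last first.
  exact: (multilinear_map_snd (Binf_multilinearl HB (map snd vs))).
rewrite [RHS](@linear_fst c) !fst_bsum.
case: vs => [|v [|w vs]]; last by rewrite scaler0 addr0.
  by case: s => [|z [|z' s]]; case: t => [|? ?] //=; rewrite ?scaler0 ?addr0.
exact: multilinear_sum_act.
Qed.

Lemma bsum_multilinearr (us : seq (A * B)) : multilinear (b' us).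
Proof.
move=> s t c x y; apply: injective_projections; last first.
  by rewrite /= !map_cat; exact: (Binf_multilinearr HB).
rewrite [RHS](@linear_fst c) !fst_bsum.
case: s => [|z [|z' s]]; case: t => [|w t] /=; rewrite ?scaler0 ?addr0 //.
exact: linear_sum_act.
Qed.

Lemma dsum_multilinear : multilinear d'.
Proof.
move=> s t c x y; apply: injective_projections; last first.
  by rewrite /= !map_cat; exact: (Ainf_multilinear (Binf_Ainfty HB)).
rewrite [RHS](@linear_fst c) !fst_dsum.
case: s => [|z [|z' s]]; case: t => [|w t] /=; rewrite ?scaler0 ?addr0 //.
exact: (dg_linear (dga_space HA)).
Qed.

Lemma sum_act_deg us i a :
  GA i a -> GA (tdeg us + i) (sum_act (vals us) a).
Proof.
move=> ha; apply: homD.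
  by rewrite vals_snd -tdeg_snd; exact: Bmod_deg Hmod _ _ _ ha.
case: us => [|u us] /=; first exact: hom0.
rewrite tdeg_cons -addrA vals_snd -tdeg_snd.
apply: (dga_deg HA); first exact: proj1 (hvalP u).
exact: Bmod_deg Hmod _ _ _ ha.
Qed.

Lemma bsum_deg us vs : GS (tdeg us + tdeg vs) (b' (vals us) (vals vs)).
Proof.
split; last by rewrite -!tdeg_snd /= !vals_snd; exact: (Binf_deg HB).
rewrite fst_bsum; case: vs => [|v [|w vs]] /=; last exact: hom0.
  rewrite tdeg_nil addr0; case: us => [|u [|? us]]; try exact: hom0.
  by rewrite tdeg_cons tdeg_nil addr0; exact: proj1 (hvalP u).
apply: sum_act_deg; rewrite tdeg_cons tdeg_nil addr0.
exact: proj1 (hvalP v).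
Qed.

Lemma dsum_deg us : GS (tdeg us + 1) (d' (vals us)).
Proof.
split; last first.
  by rewrite -tdeg_snd /= vals_snd; exact: (Ainf_deg (Binf_Ainfty HB)).
case: us => [|u [|? us]]; try exact: hom0.
rewrite tdeg_cons tdeg_nil addr0; apply: (dg_deg (dga_space HA)).
exact: proj1 (hvalP u).
Qed.

(** * The relations involving the differential *)

Lemma dsum_Ainfty : Ainfty GS d'.
Proof.
have HBA := Binf_Ainfty HB.
split=> [||us|us]; first exact: dsum_multilinear.
- by rewrite /dsum /= (Ainf_d0 HBA).
- exact: dsum_deg.
apply: injective_projections; last first.
  rewrite (linear_prop_sum linear_snd) -[RHS](Ainf_rel HBA (map homog_snd us)).
  rewrite size_map; apply: eq_bigr => p _.
  by rewrite (after_dhat_linear _ _ _ _ linear_snd) -after_dhat_snd.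
rewrite (linear_prop_sum linear_fst).
under eq_bigr do rewrite (after_dhat_linear _ _ _ _ linear_fst).
(* The A-component of [d'] vanishes on two or more factors, so only the square of [dA] on a single
   argument is left. *)
have lin0 := linear0_of (dg_linear (dga_space HA)).
rewrite sum_after_dhat_short //= ?lin0 //.
case: us => [|u [|? us]] //=.
exact: (dg_sq (dga_space HA)).
Qed.

Lemma fst_sum_after_dsum us vs :
  (\sum_(1 <= p < (size us + size vs).+1) after_b b' p d' us vs).1 =
  dA (b' (vals us) (vals vs)).1.
Proof.
rewrite (linear_prop_sum linear_fst).
under eq_bigr do rewrite (after_b_linear _ _ _ _ _ linear_fst).
by rewrite sum_after_b_short //= (linear0_of (dg_linear (dga_space HA))).
Qed.

(** The beta summand is the module relation. For the other summand, the Leibniz rule in A separates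
    the differential of the first entry from the module relation on the tail. *)
Lemma sum_act_diff us a :
  dA (sum_act (vals us) a) =
  \sum_(1 <= p < (size us).+1) after_dhat d' p (fun ts => sum_act ts a) us +
  (-1 : k) ^ tdeg us *: sum_act (vals us) (dA a).
Proof.
have lA := dg_linear (dga_space HA).
rewrite /sum_act (linear_propD lA) scalerDr.
under eq_bigr do rewrite after_dhatD.
rewrite big_split /= addrACA; congr (_ + _).
  rewrite vals_snd (Bmod_diff Hmod) size_map tdeg_snd; congr (_ + _).
  by apply: eq_bigr => p _; rewrite -after_dhat_snd.
case: us => [|u us] /=.
  by rewrite big_geq // scaler0 addr0 (linear0_of lA).
have lu := dga_linearr HA (hval u).1.
rewrite (dga_leibniz HA _ (proj1 (hvalP u))) vals_snd (Bmod_diff Hmod).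
rewrite size_map tdeg_snd (linear_propD lu) scalerDr addrA; congr (_ + _).
  rewrite big_nat; under eq_bigr => p /andP[_ le_p].
    rewrite after_dhat_cons //=; over.
  rewrite -big_nat big_split -scaler_sumr; congr (_ + _ *: _).
    (* Here [d'] starts at [u]; its A-component is nonzero only for p = 1, which gives [dA] of the
       head. *)
    rewrite big_ltn //= take0 drop0 vals_snd big_nat big1 ?addr0 // => p.
    case: p => [|[|p]] // /andP[_ lt_p]; rewrite ltnS in lt_p.
    by case: (us) lt_p => [|w ws] // _; rewrite (mul0l HA).
  (* Here [d'] acts behind [u], where the largest p no longer fits. *)
  rewrite [RHS]big_nat_recr //= after_dhat_large // addr0 (linear_prop_sum lu).
  apply: eq_bigr => p _.
  by rewrite (after_dhat_linear _ _ _ _ lu) -after_dhat_snd.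
by rewrite tdeg_cons signrD -scalerA linear_propZ.
Qed.

Lemma bsum_diff us vs :
  \sum_(1 <= p < (size us + size vs).+1) after_b b' p d' us vs =
  \sum_(1 <= p < (size us).+1)
    after_dhat d' p (fun ts => b' ts (vals vs)) us +
  (-1 : k) ^ tdeg us *:
    \sum_(1 <= p < (size vs).+1)
      after_dhat d' p (fun ts => b' (vals us) ts) vs.
Proof.
apply: injective_projections; last first.
  have := Binf_diff HB (map homog_snd us) (map homog_snd vs).
  rewrite !size_map tdeg_snd -!vals_snd (linear_propD linear_snd).
  rewrite (linear_propZ linear_snd) !(linear_prop_sum linear_snd).
  under eq_bigr do rewrite -after_b_snd.
  under [X in _ = X + _]eq_bigr do rewrite -after_dhat_snd.
  under [X in _ = _ + _ *: X]eq_bigr do rewrite -after_dhat_snd.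
  move=> E; under eq_bigr do rewrite (after_b_linear _ _ _ _ _ linear_snd).
  rewrite E; congr (_ + _ *: _);
    by apply: eq_bigr => p _; rewrite (after_dhat_linear _ _ _ _ linear_snd).
rewrite fst_sum_after_dsum (linear_propD linear_fst) (linear_propZ linear_fst).
rewrite !(linear_prop_sum linear_fst).
under [X in _ = X + _]eq_bigr do rewrite (after_dhat_linear _ _ _ _ linear_fst).
under [X in _ = _ + _ *: X]eq_bigr do
  rewrite (after_dhat_linear _ _ _ _ linear_fst).
have lA := dg_linear (dga_space HA).
rewrite [X in _ = _ + _ *: X]sum_after_dhat_short; last 2 first.
- by move=> x y ts; rewrite [LHS]fst_bsum.
- by rewrite [LHS]fst_bsum /= (linear0_of (linear_sum_act _)).
(* With [vs] empty, both sides are the A-component of [d'] on [us]; with one entry, this is the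
   Leibniz rule for Phi; with more, both sides vanish. *)
case: vs => [|v [|w vs]].
- rewrite sum_after_dhat_short //; rewrite !fst_bsum /=.
  rewrite (linear0_of (linear_sum_act _)) scaler0 addr0.
  by case: us => [|u [|? us]] //=; rewrite (linear0_of lA).
- rewrite !fst_bsum sum_act_diff; congr (_ + _).
  by apply: eq_bigr => p _; apply: eq_after_dhat => ts; rewrite fst_bsum.
rewrite [X in _ = X + _]big1 => [|p _]; last first.
  by rewrite /after_dhat big1 // => i _; rewrite fst_bsum scaler0.
by rewrite !fst_bsum /= (linear0_of (linear_sum_act _)) scaler0 addr0
  (linear0_of lA).
Qed.

(** * The associativity relation *)

(* The first tensor factor of [b_p (us; vs)] is split off as [(i, j)]; the sum
   over the other factors is given by the module relation, except for
   [(i, j) = (0, 0)], where the summation range is too short but the first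
   factor vanishes. *)
Lemma sum_after_b_head_mul us vs a :
  \sum_(0 <= p < (size us + size vs).+1)
    after_b b' p (fun ts => head_mul ts a) us vs =
  \sum_(0 <= i < (size us).+1) \sum_(0 <= j < (size vs).+1)
    (-1 : k) ^ (tdeg (drop i us) * tdeg (take j vs)) *:
      mul (b' (vals (take i us)) (vals (take j vs))).1
        (beta (map snd (vals (drop i us))) (beta (map snd (vals (drop j vs))) a)).
Proof.
rewrite big_nat_recl // after_b0 if_same add0r.
under eq_bigr do rewrite after_bS.
rewrite exchange_big big_nat [RHS]big_nat; apply: eq_bigr => i /andP[_ lei].
rewrite exchange_big big_nat [RHS]big_nat; apply: eq_bigr => j /andP[_ lej].
rewrite -scaler_sumr; congr (_ *: _).
set x := b' _ _; have lx := dga_linearr HA x.1.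
under eq_bigr do rewrite /= -(after_b_linear _ _ _ _ _ lx).
rewrite -(linear_prop_sum lx).
case: (posnP (i + j)) => [/eqP|ij_gt0].
  rewrite addn_eq0 => /andP[/eqP i0 /eqP j0].
  by rewrite /x i0 j0 !take0 fst_bsum /= !(mul0l HA).
congr (mul _ _); under eq_bigr do rewrite (after_b_snd (fun ts => beta ts a)).
rewrite sum_after_b_widen //; first by rewrite (Bmod_assoc Hmod) !vals_snd.
  exact: Bmod_multilinearl Hmod a.
rewrite !size_map !size_drop.
by move: (size us) (size vs) lei lej ij_gt0 => m n; lia.
Qed.

(** Both summands of Phi come from the compatibility of beta with the product: the first directly,
    the second on the tail of [us], followed by associativity in A. *)
Lemma sum_act_mul us (v : homog GS) a :
  sum_act (vals us) (mul (hval v).1 a) =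
  \sum_(0 <= i < (size us).+1)
    (-1 : k) ^ (tdeg (drop i us) * hdeg v) *:
      mul (sum_act (vals (take i us)) (hval v).1)
        (beta (map snd (vals (drop i us))) a).
Proof.
under eq_bigr do rewrite (linear_propD (dga_linearl HA _)) scalerDr.
rewrite big_split /=; congr (_ + _).
  rewrite vals_snd (Bact_mul Hbeta _ (homog_fst v)) size_map.
  apply: eq_bigr => i _; rewrite -map_drop -map_take tdeg_snd mulrC.
  by rewrite !vals_snd.
(* The term i = 0 has no head; dropping it matches the sum with the one over splittings of the
   tail. *)
rewrite big_nat_recl // take0 /= (mul0l HA) scaler0 add0r.
case: us => [|u us] /=; first by rewrite big_geq.
rewrite vals_snd (Bact_mul Hbeta _ (homog_fst v)) size_map.
rewrite (linear_prop_sum (dga_linearr HA _)); apply: eq_bigr => i _.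
rewrite (linear_propZ (dga_linearr HA _)) (dga_assoc HA).
by rewrite -map_drop -map_take tdeg_snd mulrC !vals_snd.
Qed.

(** The module relation yields beta (us; beta (vs; a)). The head summand is sorted by the number j
    of entries of [vs] in the first factor: j = 0 and j = 1 give the two remaining pieces of the
    right-hand side, and j > 1 gives 0. *)
Lemma sum_act_assoc us vs a :
  \sum_(0 <= p < (size us + size vs).+1)
    after_b b' p (fun ts => sum_act ts a) us vs =
  sum_act (vals us) (sum_act (vals vs) a).
Proof.
under eq_bigr do rewrite after_bD.
rewrite big_split sum_after_b_head_mul.
under eq_bigr do rewrite (after_b_snd (fun ts => beta ts a)).
rewrite -!(size_map homog_snd) (Bmod_assoc Hmod) !size_map -!vals_snd.
rewrite [sum_act (vals vs) a]/sum_act (linear_propD (linear_sum_act _)).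
rewrite [sum_act (vals us) (beta _ _)]/sum_act -addrA; congr (_ + _).
under eq_bigr => i _.
  rewrite big_nat_recl // take0 drop0 tdeg_nil mulr0 scale1r fst_bsum.
  over.
rewrite big_split; congr (_ + _).
  (* For j = 0 the first factor is b'_(i,0), nonzero only for i = 1; this is [head_mul] of [us]. *)
  rewrite big_nat_recl //= take0 (mul0l HA) add0r.
  case: us => [|u us]; first by rewrite big_geq.
  rewrite /= big_ltn // big_nat big1 ?addr0 ?take0 ?drop0 // => -[|i] //.
  by case: us => // u' us _ /=; rewrite (mul0l HA).
case: vs => [|v vs].
  rewrite [head_mul _ _]/= (linear0_of (linear_sum_act _)) big1 // => i _.
  by rewrite big_geq.
(* For j = 1 the first factor has A-component Phi (u_1, ..., u_i; v_1), as in the expansion of Phi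
   on a product. *)
rewrite [head_mul _ _]/= sum_act_mul; apply: eq_bigr => i _.
have take1 : take 1 (v :: vs) = [:: v] by rewrite /= take0.
have drop1 : drop 1 (v :: vs) = vs by rewrite /= drop0.
rewrite big_nat_recl // take1 drop1 tdeg_cons tdeg_nil addr0 fst_bsum.
rewrite big_nat big1 ?addr0 // => j lt_j.
by case: (vs) lt_j => [|w vs'] // _; rewrite fst_bsum (mul0l HA) scaler0.
Qed.

Lemma bsum_assoc us vs ws :
  \sum_(0 <= p < (size us + size vs).+1)
    after_b b' p (fun ts => b' ts (vals ws)) us vs =
  \sum_(0 <= p < (size vs + size ws).+1)
    after_b b' p (fun ts => b' (vals us) ts) vs ws.
Proof.
apply: injective_projections; last first.
  have := Binf_assoc HB (map homog_snd us) (map homog_snd vs)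
    (map homog_snd ws).
  rewrite !size_map -!vals_snd !(linear_prop_sum linear_snd).
  under eq_bigr do rewrite -after_b_snd.
  under [X in _ = X -> _]eq_bigr do rewrite -after_b_snd.
  move=> E; under eq_bigr do rewrite (after_b_linear _ _ _ _ _ linear_snd).
  rewrite E.
  by apply: eq_bigr => p _; rewrite (after_b_linear _ _ _ _ _ linear_snd).
rewrite !(linear_prop_sum linear_fst).
under eq_bigr do rewrite (after_b_linear _ _ _ _ _ linear_fst).
under [RHS]eq_bigr do rewrite (after_b_linear _ _ _ _ _ linear_fst).
have act0 ts := linear0_of (linear_sum_act ts).
(* The empty tensor p = 0 is kept apart: it contributes exactly when [vs] and [ws] are empty, and
   the reduction to one factor starts at p = 1. *)
rewrite [RHS]big_ltn // sum_after_b_short; last 2 first.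
- by move=> x y ts; rewrite [LHS]fst_bsum.
- by rewrite [LHS]fst_bsum /= act0.
rewrite after_b0 fst_bsum1.
(* With [ws] empty, both sides are the A-component of [b'] on [us] and [vs]; with one entry, this is
   the associativity of Phi; with more, both sides vanish. *)
case: ws => [|w [|w' ws]].
- rewrite big_ltn // after_b0 (fst_bsum [::]) if_same add0r.
  rewrite sum_after_b_short; last 2 first.
  + by move=> x y ts; rewrite [LHS]fst_bsum.
  + by rewrite [LHS]fst_bsum fst_bsum.
  rewrite andbT !fst_bsum.
  by case: vs => [|v [|w vs]]; rewrite ?act0 ?addr0 ?add0r.
- rewrite andbF add0r fst_bsum -sum_act_assoc; apply: eq_bigr => p _.
  by apply: eq_after_b => ts; rewrite fst_bsum.
rewrite andbF add0r (fst_bsum (vals vs)) act0 big1 // => p _.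
by rewrite /after_b big1 // => i _; rewrite big1 // => j _;
  rewrite fst_bsum scaler0.
Qed.

End SumAction.

Theorem lemma4 (k : fieldType) (char0 : [pchar k]%R =i pred0)
  (B : lmodType k) (GB : grading B)
  (b : seq B -> seq B -> B) (d : seq B -> B)
  (HB : Binfty GB b d)
  (A : lmodType k) (GA : grading A) (mul : A -> A -> A) (dA : A -> A)
  (HA : dg_algebra GA mul dA)
  (beta : seq B -> A -> A)
  (Hbeta : Baction GB b d GA mul dA beta) :
  Binfty (sum_grading GA GB) (bsum mul b beta) (dsum dA d).
Proof.
split.
- exact (bsum_multilinearl HB HA Hbeta).
- exact (bsum_multilinearr HB HA Hbeta).
- exact (bsum_deg HB HA Hbeta).
- exact: (bsum_unit1 mul beta HB).
- exact: (bsum_unit2 mul beta HB).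
- exact: (bsum_unit3 mul beta HB).
- exact: (bsum_unit4 mul beta HB).
- exact (dsum_Ainfty HB HA).
- exact (bsum_assoc HB HA Hbeta).
- exact (bsum_diff HB HA Hbeta).
Qed.
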